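(* Let $B$ be an oriented graph. If $B$ has the directed forcing property, then $B$ has a homomorphism to $\vec K_2$ and the underlying undirected graph $\overline{B}$ contains a cycle.
   Context: All graphs are finite with non-empty vertex set. An oriented graph is a directed graph obtained from a simple undirected graph by orienting each edge (so there are no loops and at most one of $(x,y),(y,x)$ is an edge). $v(G)$ and $e(G)$ denote the numbers of vertices and edges of $G$. $\vec K_2$ is the oriented graph with two vertices and a single directed edge. $\overline{B}$ denotes the undirected graph obtained from $B$ by forgetting the directions of all edges. A homomorphism of oriented graphs $f:V(B)\to V(G)$ is a map such that $(f(x),f(y))\in E(G)$ whenever $(x,y)\in E(B)$. The homomorphism density $t(B,G)$ is the number of homomorphisms from $B$ to $G$ divided by $v(G)^{v(B)}$; in particular $t(\vec K_2,G)=e(G)/v(G)^2$. For a directed graph $G$ on vertex set $\{1,\dots,n\}$, the associated directed graphon $W_G:[0,1]^2\to[0,1]$ is obtained by partitioning $[0,1]$ into $n$ intervals $I_1,\dots,I_n$ of equal length and setting $W_G(x,y)=1$ if $x\in I_i$, $y\in I_j$ with $(i,j)\in E(G)$, and $W_G(x,y)=0$ otherwise. For a bounded measurable $U:[0,1]^2\to\mathbb{R}$, the cut norm is $\|U\|_\square=\sup_{S,T}\left|\int_{S\times T}U(x,y)\,dx\,dy\right|$, the supremum over measurable $S,T\subset[0,1]$. For $q\in[0,1]$, a sequence of directed graphs $\{G_n\}_{n\in\mathbb{N}}$ is $q$-quasirandom if $\lim_{n\to\infty}\|W_{G_n}-q\|_\square=0$, where $q$ denotes the constant function. An oriented graph $B$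 has the directed forcing property if for every $p\in[0,1]$ and every sequence of oriented graphs $\{G_n\}_{n\in\mathbb{N}}$ with $t(\vec K_2,G_n)\to p/2$ and $t(B,G_n)\to (p/2)^{e(B)}$ as $n\to\infty$, the sequence $\{G_n\}_{n\in\mathbb{N}}$ is $(p/2)$-quasirandom. *)

(* Defs.v *)
From HB Require Import structures.
From mathcomp Require Import all_boot all_order all_algebra.
From mathcomp Require Import all_classical all_reals all_analysis.
Import Order.TTheory GRing.Theory Num.Theory.
Import numFieldNormedType.Exports.

Set Implicit Arguments.
Unset Strict Implicit.
Unset Printing Implicit Defensive.

Local Open Scope classical_set_scope.
Local Open Scope ring_scope.

Record digraph := Digraph {
  vertex :> finType;
  edge : rel vertex;
  vertex_gt0 : (0 < #|vertex|)%N }.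

Arguments edge : clear implicits.

Definition oriented (G : digraph) : Prop :=
  (forall x, ~~ edge G x x) /\
  (forall x y, ~~ (edge G x y && edge G y x)).

Definition nb_vertices (G : digraph) : nat := #|G|.

Definition nb_edges (G : digraph) : nat :=
  #|[set e : G * G | edge G e.1 e.2]%SET|.

Lemma card_bool_gt0 : (0 < #|{: bool}|)%N.
Proof. by rewrite card_bool. Qed.

Definition vecK2 : digraph :=
  @Digraph bool (fun x y => ~~ x && y) card_bool_gt0.

Definition is_hom (B G : digraph) (f : B -> G) : bool :=
  [forall x, forall y, edge B x y ==> edge G (f x) (f y)].

Definition has_hom (B G : digraph) : Prop := exists f : B -> G, is_hom f.

Definition nb_hom (B G : digraph) : nat :=
  #|[set f : {ffun B -> G} | is_hom f]%SET|.

Definition hom_density (R : realType) (B G : digraph) : R :=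
  (nb_hom B G)%:R / (nb_vertices G)%:R ^+ nb_vertices B.

Definition underlying (B : digraph) : rel B :=
  fun x y => edge B x y || edge B y x.

Arguments underlying : clear implicits.

(* [ucycle] also accepts closed walks of length less than 3 (a single edge
   traversed back and forth), which are not cycles of a simple graph. *)
Definition contains_cycle (T : eqType) (e : rel T) : Prop :=
  exists2 c : seq T, (3 <= size c)%N & ucycle e c.

(* The i-th interval (i < n) of the partition of [0, 1] into n intervals of
   length 1/n; the last one is closed on the right. *)
Definition cell (R : realType) (n i : nat) : set R :=
  if i.+1 == n then `[i%:R / n%:R, 1]%classic
  else `[i%:R / n%:R, i.+1%:R / n%:R[%classic.

(* Vertices are numbered by [enum_rank]. *)
Definition graphon (R : realType) (G : digraph) : R * R -> R :=
  \1_[set z : R * R | exists u v : G, [/\ edge G u v,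
        cell #|G| (enum_rank u) z.1 & cell #|G| (enum_rank v) z.2]].

Definition cut_norm (R : realType) (U : R * R -> R) : R :=
  sup [set r | exists S T : set R,
    [/\ measurable S, measurable T, S `<=` `[0, 1]%classic,
        T `<=` `[0, 1]%classic &
      r = `|Rintegral (lebesgue_measure \x lebesgue_measure)%E
              (S `*` T) U| ] ].

Definition quasirandom (R : realType) (q : R) (G : nat -> digraph) : Prop :=
  (fun n => cut_norm (fun z => graphon (G n) z - q)) @ \oo --> (0 : R).

Definition directed_forcing (R : realType) (B : digraph) : Prop :=
  forall (p : R) (G : nat -> digraph),
    0 <= p <= 1 ->
    (forall n, oriented (G n)) ->
    (fun n => hom_density R vecK2 (G n)) @ \oo --> p / 2 ->
    (fun n => hom_density R B (G n)) @ \oo --> (p / 2) ^+ nb_edges B ->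
    quasirandom (p / 2) G.

(* Main.v *)
(** If [B] has no homomorphism to [vecK2], some vertex of [B] is both a head and a
    tail, so at most [2 e(B) - 1] vertices of [B] are not isolated. On a vertex set
    much larger than [B], a blow-up of [B] with edge density [q] therefore has
    [t(B, _) >= q ^ e(B)], whereas [t(B, _) = 0] for a bipartite graph with all edges
    oriented the same way. Replacing the edges of the second graph by
    those of the first one at a time changes [t(B, _)] by [O(1 / N ^ 2)] at each
    step, so some intermediate graph has [t(B, _)] almost equal to [q ^ e(B)]; it has
    an independent set of linear size, hence is not quasirandom.

    If [B] is acyclic, then [t(B, C) = (1 / 3) ^ e(B)] for the directed triangle [C],
    and the constant sequence [C] is not quasirandom. *)
Require Import Defs.
From mathcomp Require Import all_boot all_order all_algebra.
From mathcomp Require Import all_classical all_reals all_analysis.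
Import Order.TTheory GRing.Theory Num.Theory.
Import numFieldNormedType.Exports.

Set Implicit Arguments.
Unset Strict Implicit.
Unset Printing Implicit Defensive.

Local Open Scope classical_set_scope.
Local Open Scope ring_scope.

(** * The cut norm *)

Section CutNorm.
Variable R : realType.

Lemma measurable_cell n i : measurable (@cell R n i).
Proof. by rewrite /cell; case: ifP => _; exact: measurable_itv. Qed.

Lemma cell_subset_unit n i : (i < n)%N -> @cell R n i `<=` `[0, 1].
Proof.
move=> lt_in x; rewrite /cell.
have n0 : 0 < n%:R :> R by rewrite ltr0n (leq_ltn_trans _ lt_in).
have le0 : 0 <= i%:R / n%:R :> R by rewrite divr_ge0 // ler0n.
have le1 : i.+1%:R / n%:R <= 1 :> R by rewrite ler_pdivrMr // mul1r ler_nat.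
case: ifP => _; rewrite /= !in_itv /= => /andP[h1 h2].
  by rewrite h2 (le_trans le0).
by rewrite (le_trans le0 h1) (le_trans (ltW h2)).
Qed.

Lemma trivIset_cell n : trivIset [set: 'I_n] (fun i : 'I_n => @cell R n i).
Proof.
(* As [i < j], cell [i] is not the last one, hence half-open; only cell [j] may be closed on the
   right. *)
have lt_cell (i j : 'I_n) x : (i < j)%N -> @cell R n i x -> @cell R n j x -> False.
  move=> lt_ij; rewrite /cell ltn_eqF; last exact: leq_ltn_trans (ltn_ord j).
  rewrite /= in_itv /= => /andP[_ ltx].
  have n0 : 0 < n%:R :> R by rewrite ltr0n (leq_ltn_trans _ (ltn_ord j)).
  have lej : i.+1%:R / n%:R <= j%:R / n%:R :> R by rewrite ler_pM2r ?invr_gt0// ler_nat.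
  by case: ifP => _; rewrite /= in_itv /= => /andP[lex _];
    have := lt_le_trans ltx (le_trans lej lex); rewrite ltxx.
move=> i j _ _ [x [xi xj]]; case: (ltngtP i j) => [lt|lt|/val_inj //].
  by case: (lt_cell i j x lt xi xj).
by case: (lt_cell j i x lt xj xi).
Qed.

Lemma lebesgue_measure_cell n i : (i < n)%N ->
  lebesgue_measure (@cell R n i) = (n%:R^-1)%:E.
Proof.
move=> lt_in.
have n0 : 0 < n%:R :> R by rewrite ltr0n (leq_ltn_trans _ lt_in).
have lt1 : i%:R / n%:R < i.+1%:R / n%:R :> R by rewrite ltr_pM2r ?invr_gt0// ltr_nat.
have eq1 : (i.+1%:R / n%:R - i%:R / n%:R)%:E = (n%:R^-1)%:E :> \bar R.
  by rewrite -mulrBl -addn1 natrD addrAC subrr add0r mul1r.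
rewrite /cell; case: eqP => [e|_]; rewrite lebesgue_measure_itv /= lte_fin ?lt1 -eq1 //.
by move: lt1; rewrite e divff ?gt_eqF // => ->.
Qed.

Definition cells (G : digraph) (A : {set G}) : set R :=
  \bigcup_(u in [set` A]) @cell R #|G| (enum_rank u).

Lemma measurable_cells (G : digraph) (A : {set G}) : measurable (cells A).
Proof. by apply: fin_bigcup_measurable => // i _; exact: measurable_cell. Qed.

Lemma cells_subset_unit (G : digraph) (A : {set G}) : cells A `<=` `[0, 1].
Proof. by apply: bigcup_sub => u _; exact: cell_subset_unit. Qed.

Lemma trivIset_vertex_cell (G : digraph) :
  trivIset [set: G] (fun u => @cell R #|G| (enum_rank u)).
Proof.
move=> u v _ _ uv; apply: enum_rank_inj.
exact: (trivIset_cell (i := enum_rank u) (j := enum_rank v)).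
Qed.

Lemma lebesgue_measure_cells (G : digraph) (A : {set G}) :
  lebesgue_measure (cells A) = (#|A|%:R / #|G|%:R)%:E.
Proof.
rewrite measure_fin_bigcup //; first last.
- by move=> i _; exact: measurable_cell.
- exact: sub_trivIset (@trivIset_vertex_cell G).
have -> : [set` A] = [set` enum A] by apply/seteqP; split=> x; rewrite /= mem_enum.
rewrite -fsbig_seq ?enum_uniq //.
rewrite (eq_bigr (fun=> (#|G|%:R^-1)%:E)); last by move=> i _; exact: lebesgue_measure_cell.
by rewrite sumEFin big_enum sumr_const mulr_natl.
Qed.

Lemma measurable_graphon (G : digraph) : measurable_fun [set: R * R] (@graphon R G).
Proof.
apply: measurable_realfun.measurable_indic.
rewrite [X in measurable X](_ : _ = \bigcup_(e in [set` [set e : G * G | edge G e.1 e.2]%SET])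
   (@cell R #|G| (enum_rank e.1) `*` @cell R #|G| (enum_rank e.2))).
  by apply: fin_bigcup_measurable => // e _; apply: measurableX; exact: measurable_cell.
apply/seteqP; split=> z.
  by move=> [u [v [uv zu zv]]]; exists (u, v) => //=; rewrite inE.
by move=> [[u v] /=]; rewrite inE => uv [zu zv]; exists u, v.
Qed.

(** The uniform bound [c] makes the set of integrals bounded above, because [S] and [T] have measure
    at most 1; only then is its [sup] a genuine supremum. *)
Lemma cut_norm_ge (c : R) (U : R * R -> R) (S T : set R) :
  measurable_fun [set: R * R] U -> (forall z, `|U z| <= c) ->
  measurable S -> measurable T -> S `<=` `[0, 1] -> T `<=` `[0, 1] ->
  `|Rintegral (lebesgue_measure \x lebesgue_measure)%E (S `*` T) U| <= cut_norm U.
Proof.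
move=> mU bU mS mT S01 T01; apply: ub_le_sup; last by exists S, T.
exists c => r [S' [T' [mS' mT' S'01 T'01 ->]]].
have c0 : 0 <= c by apply: le_trans (bU 0).
have le1 (X : set R) : measurable X -> X `<=` `[0, 1] -> (lebesgue_measure X <= 1)%E.
  move=> mX X01; apply: (@le_trans _ _ (lebesgue_measure (`[0, 1]%classic : set R))).
    by apply: le_measure; rewrite ?inE //; exact: measurable_itv.
  by rewrite lebesgue_measure_itv /= lte01 sube0.
have mST : measurable (S' `*` T') by exact: measurableX.
have ST1 : ((lebesgue_measure \x lebesgue_measure) (S' `*` T') <= 1)%E.
  rewrite product_measure1E // -[leRHS]mule1.
  by apply: lee_pmul => //; exact: le1.
have iU : (lebesgue_measure \x lebesgue_measure)%E.-integrable (S' `*` T') (EFin \o U).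
  apply: measurable_bounded_integrable => //.
  - exact: le_lt_trans ST1 (ltry _).
  - exact: measurable_funTS.
  - exists c; split; first exact: num_real.
    by move=> M cM z _; apply: le_trans (bU z) (ltW cM).
rewrite -lee_fin EFin_normr_Rintegral //.
apply: le_trans (le_abse_integral _ _ _) _ => //; first exact: (measurable_int _ iU).
apply: le_trans (integral_le_bound c%:E _ _ _ _) _ => //.
- exact: (measurable_int _ iU).
- by apply: aeW => z _ /=; rewrite lee_fin.
- by rewrite -[leRHS]mule1 lee_wpmul2l.
Qed.

(** Test the cut norm on the square of [cells A]: the graphon vanishes there, so the integrand is
    the constant [- q] and only the area of the square remains. *)
Lemma cut_norm_independent (G : digraph) (A : {set G}) (q : R) : 0 <= q ->
  (forall u v, u \in A -> v \in A -> ~~ edge G u v) ->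
  q * (#|A|%:R / #|G|%:R) ^+ 2 <= cut_norm (fun z => @graphon R G z - q).
Proof.
move=> q0 indA.
have mA := measurable_cells A; have A01 := @cells_subset_unit G A.
apply: le_trans (@cut_norm_ge (1 + q) _ _ _ _ _ mA mA A01 A01); last first.
- move=> z; apply: le_trans (ler_normB _ _) _; rewrite (ger0_norm q0) lerD2r.
  by rewrite /graphon indicE; case: (_ \in _); rewrite ?normr1 ?normr0.
- by apply: measurable_realfun.measurable_funB => //; exact: measurable_graphon.
rewrite (eq_Rintegral _ (g := fun _ => - q)); last first.
  move=> z; rewrite inE => -[[u /= uA zu] [v /= vA zv]].
  rewrite /graphon indicE memNset ?sub0r // => -[u' [v' [uv zu' zv']]].
  (* Cells are disjoint, so a point of the square determines its pair of vertices, and both lie in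
     [A]. *)
  have eu : u = u' by apply: (trivIset_vertex_cell (G := G)) => //; exists z.1.
  have ev : v = v' by apply: (trivIset_vertex_cell (G := G)) => //; exists z.2.
  by move: uv; rewrite -eu -ev (negbTE (indA _ _ _ _)).
rewrite Rintegral_cst; last exact: measurableX.
rewrite [X in fine X]product_measure1E // [X in fine X](_ : _ = ((#|A|%:R / #|G|%:R) ^+ 2)%:E).
  by rewrite normrM normrN (ger0_norm q0) /= (ger0_norm (sqr_ge0 _)).
by rewrite expr2 EFinM; congr (_ * _)%E; exact: lebesgue_measure_cells.
Qed.

End CutNorm.

(** * Acyclic graphs *)

Definition edge_set (G : digraph) : {set G * G} := [set e : G * G | edge G e.1 e.2]%SET.

Section AcyclicHoms.
Variable V : finType.
Implicit Types S : {set V * V}.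

(** Arcs are kept as a set of pairs, not inside a [digraph], so that an induction can delete them
    one at a time. *)
Definition adjacent S : rel V := fun x y => ((x, y) \in S) || ((y, x) \in S).

(** Addition in ['I_3] is modulo 3, so these are the homomorphisms to the directed triangle. *)
Definition rotations S : {set {ffun V -> 'I_3}} :=
  [set f : {ffun V -> 'I_3} | [forall e in S, f e.2 == f e.1 + 1]]%SET.

Lemma connect_adjacentC S : connect_sym (adjacent S).
Proof. by apply: sym_connect_sym => x y; rewrite /adjacent orbC. Qed.

(** A simple path from [v] to [u] that avoids the arc [(u, v)] is closed by this arc into a
    cycle. *)
Lemma connect_cycle S u v :
  (forall x, (x, x) \notin S) ->
  (forall x y, (x, y) \in S -> (y, x) \notin S) ->
  (u, v) \in S -> connect (adjacent (S :\ (u, v))%SET) v u ->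
  contains_cycle (adjacent S).
Proof.
move=> irr anti uvS /connectP[p0 pth0 e0].
case/shortenP: pth0 e0 => p pth up _ eu {p0}.
(* The cycle [v :: p] needs three vertices. An empty [p] would make [(u, v)] a loop, and a one-step
   [p] would put the reverse arc [(v, u)] in [S]. *)
have [sz|sz] := leqP 2 (size p); last first.
  case: p sz pth up eu => [|w [|//]] _ /=.
    by move=> _ _ uv; move: (irr v); rewrite -{1}uv uvS.
  rewrite andbT => vw _ euw; move: vw; rewrite -euw /adjacent !inE eqxx /= orbF.
  by case/andP=> _ vuS; move: (anti _ _ uvS); rewrite vuS.
exists (v :: p) => //; apply/andP; split => //=.
rewrite rcons_path -eu {2}/adjacent uvS andbT.
apply: sub_path pth => x y; rewrite /adjacent !inE.
by case/orP => /andP[_ ->]; rewrite ?orbT.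
Qed.

(* The translates of a rotation by a constant on the component of [v] take each
   value of [f v - f u] equally often. *)
Lemma card_rotations_step S u v :
  (u, v) \in S -> ~~ connect (adjacent (S :\ (u, v))%SET) v u ->
  #|rotations (S :\ (u, v))%SET| = (3 * #|rotations S|)%N.
Proof.
set S' := (S :\ (u, v))%SET => uvS nvu.
pose shift k (f : {ffun V -> 'I_3}) :=
  [ffun x => if connect (adjacent S') v x then f x + k else f x].
pose level k := [set f in rotations S' | f v - f u == k]%SET.
have shift_inj k : injective (shift k).
  move=> f g /ffunP fg; apply/ffunP => x; have := fg x; rewrite !ffunE.
  by case: ifP => // _ /addIr.
have shift_level k j f : f \in level j -> shift k f \in level (j + k).
  rewrite !inE => /andP[/forallP fS' /eqP fj]; apply/andP; split.
    apply/forallP => -[x y]; apply/implyP => xyS'.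
    have /implyP/(_ xyS')/eqP /= fxy := fS' (x, y).
    have /(same_connect_r (connect_adjacentC S'))/(_ v) cxy : connect (adjacent S') x y.
      by apply: connect1; rewrite /adjacent xyS'.
    by rewrite /= !ffunE -cxy fxy; case: ifP => // _; rewrite addrAC.
  by rewrite !ffunE connect0 (negbTE nvu) addrAC fj.
(* Shifting by [k - j] injects level [j] into level [k]; by symmetry the three levels have the same
   size. *)
have level_le j k : (#|level j| <= #|level k|)%N.
  rewrite -(card_imset _ (shift_inj (k - j))); apply: subset_leq_card.
  apply/fintype.subsetP => _ /imsetP[f fj ->].
  by have := shift_level (k - j) j f fj; rewrite addrCA subrr addr0.
(* Restoring the arc [(u, v)] imposes exactly the condition [f v - f u = 1]. *)
have -> : rotations S = level 1.
  apply/setP => f; rewrite !inE; apply/forallP/andP => [fS|[/forallP fS' /eqP f1] [x y]].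
    have /implyP/(_ uvS)/eqP /= -> := fS (u, v); split; last by rewrite addrAC subrr add0r.
    apply/forallP => e; apply/implyP; rewrite !inE => /andP[_ eS].
    by have /implyP := fS e; apply.
  apply/implyP => xyS /=; have [[-> ->]|ne] := eqVneq (x, y) (u, v).
    by rewrite -f1 addrC subrK.
  by have /implyP /= := fS' (x, y); apply; rewrite !inE ne.
rewrite -sum1_card (partition_big (fun f : {ffun V -> 'I_3} => f v - f u) xpredT) //=.
rewrite (eq_bigr (fun=> #|level 1|)).
  by rewrite sum_nat_const card_ord.
move=> k _; rewrite sum1dep_card; apply/eqP.
by rewrite -/(level k) eqn_leq !level_le.
Qed.

(** Induction on the number of arcs: without cycles every arc is a bridge, so deleting it multiplies
    the count by 3, until no arc is left and all [3 ^ #|V|] maps qualify. *)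
Lemma card_rotations S :
  (forall x, (x, x) \notin S) ->
  (forall x y, (x, y) \in S -> (y, x) \notin S) ->
  ~ contains_cycle (adjacent S) ->
  (#|rotations S| * 3 ^ #|S| = 3 ^ #|V|)%N.
Proof.
have [n] := ubnP #|S|; elim: n S => // n IH S le_Sn irr anti acyc.
have [->|[[u v] uvS]] := set_0Vmem S.
  have -> : (3 ^ #|V| = #|{ffun V -> 'I_3}|)%N by rewrite card_ffun card_ord.
  rewrite cards0 muln1.
  rewrite -cardsT; congr #|pred_of_set _|; apply/setP => f; rewrite !inE.
  by apply/forallP => e; rewrite inE.
have sub x y : (x, y) \in (S :\ (u, v))%SET -> (x, y) \in S by rewrite inE => /andP[].
rewrite (cardsD1 (u, v)) uvS expnD expn1 mulnA [(_ * 3)%N]mulnC.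
rewrite -(card_rotations_step uvS); last first.
  by apply/negP => /(connect_cycle irr anti uvS).
apply: IH => //.
- by move: le_Sn; rewrite (cardsD1 (u, v)) uvS.
- by move=> x; apply: contra (irr x); exact: sub.
- by move=> x y /sub /anti; apply: contra; exact: sub.
- case=> c sz /andP[cyc uc]; apply: acyc; exists c => //; apply/andP; split => //.
  apply: sub_cycle cyc => x y; rewrite /adjacent.
  by case/orP => /sub ->; rewrite ?orbT.
Qed.

End AcyclicHoms.

Lemma card_ord3_gt0 : (0 < #|'I_3|)%N. Proof. by rewrite card_ord. Qed.

Definition triangle : digraph := @Digraph 'I_3 (fun x y => y == x + 1) card_ord3_gt0.

Lemma oriented_triangle : oriented triangle.
Proof.
split; first by move=> [[|[|[|//]]] lt].
by move=> [[|[|[|//]]] lt] [[|[|[|//]]] lt'].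
Qed.

Lemma nb_hom_triangle (B : digraph) : oriented B -> ~ contains_cycle (underlying B) ->
  (nb_hom B triangle * 3 ^ nb_edges B = 3 ^ nb_vertices B)%N.
Proof.
move=> [irr anti] acyc.
have -> : nb_hom B triangle = #|rotations (edge_set B)|.
  congr #|pred_of_set _|; apply/setP => f; rewrite !inE.
  apply/forallP/forallP => [h [x y]|h x].
    by rewrite inE; move/forallP: (h x) => /(_ y).
  by apply/forallP => y; have := h (x, y); rewrite inE.
apply: card_rotations.
- by move=> x; rewrite inE.
- by move=> x y; rewrite !inE /= => xy; have := anti x y; rewrite xy.
- case=> c sz cyc; apply: acyc; exists c => //.
  by move: cyc; congr (_ && _); apply: eq_cycle => x y; rewrite /adjacent !inE.
Qed.

Lemma hom_density_triangle (R : realType) (B : digraph) :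
  oriented B -> ~ contains_cycle (underlying B) ->
  hom_density R B triangle = (3%:R^-1) ^+ nb_edges B.
Proof.
move=> oB acyc; have h := nb_hom_triangle oB acyc.
rewrite /hom_density /nb_vertices /= card_ord exprVn.
have e0 k : 3%:R ^+ k != 0 :> R by rewrite expf_neq0 // pnatr_eq0.
by apply: (mulIf (e0 (nb_edges B))); rewrite mulVf // mulrAC -!natrX -natrM h natrX divff.
Qed.

(** * Edge densities, large independent sets and the constant triangle sequence *)

Lemma nb_hom_vecK2 (G : digraph) : nb_hom vecK2 G = nb_edges G.
Proof.
pose g (e : G * G) : {ffun vecK2 -> G} := [ffun b : bool => if b then e.2 else e.1].
have g_inj : injective g.
  by move=> [a b] [c d] /ffunP e; have := e true; have := e false; rewrite !ffunE /= => -> ->.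
rewrite /nb_edges -(card_imset _ g_inj); congr #|pred_of_set _|; apply/setP => f.
rewrite inE; apply/idP/imsetP => [hf|[e]].
  exists (f false, f true); last by apply/ffunP => -[]; rewrite ffunE.
  by rewrite inE; move/forallP: hf => /(_ false)/forallP/(_ true).
rewrite inE => ee ->; apply/forallP => -[]; apply/forallP => -[]; rewrite ?ffunE //.
Qed.

Lemma hom_density_vecK2 (R : realType) (G : digraph) :
  hom_density R vecK2 G = (nb_edges G)%:R / (nb_vertices G)%:R ^+ 2.
Proof. by rewrite /hom_density nb_hom_vecK2 {2}/nb_vertices card_bool. Qed.

Lemma nb_edges_triangle : nb_edges triangle = 3.
Proof.
rewrite /nb_edges -[RHS](card_ord 3).
rewrite -(card_imset _ (f := fun x : 'I_3 => (x, x + 1 : 'I_3))); last by move=> x y [].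
congr #|pred_of_set _|; apply/setP => -[x y]; rewrite inE /=.
by apply/eqP/imsetP => [->|[z _ [-> ->]]//]; exists x.
Qed.

(** Independent sets of density at least [d] keep the cut norm at or above [q * d ^+ 2], away from
    0. *)
Lemma not_quasirandom (R : realType) (q d : R) (G : nat -> digraph)
    (A : forall n, {set G n}) : 0 < q -> 0 < d ->
  (forall n u v, u \in A n -> v \in A n -> ~~ edge (G n) u v) ->
  (forall n, d <= #|A n|%:R / #|G n|%:R) -> ~ quasirandom q G.
Proof.
move=> q0 d0 indA dA /cvgrPdist_lt /(_ (q * d ^+ 2)).
case; first by rewrite mulr_gt0 // exprn_gt0.
move=> N _ /(_ N (leqnn N)) /=; apply/negP; rewrite -leNgt.
rewrite sub0r normrN; apply: le_trans (ler_norm _).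
apply: le_trans (cut_norm_independent (ltW q0) (indA N)).
by rewrite ler_pM2l // lerXn2r ?nnegrE ?(ltW d0) // ?(le_trans (ltW d0)).
Qed.

Lemma directed_forcing_cycle (R : realType) (B : digraph) : oriented B ->
  directed_forcing R B -> contains_cycle (underlying B).
Proof.
move=> oB forc; apply: contrapT => acyc.
(* The choice is [p = 2 / 3]: three arcs on three vertices give edge density 3/9, which is
   [p / 2]. *)
have p2 : 2 / 3 / 2 = 3^-1 :> R by rewrite mulrAC divff ?pnatr_eq0 // mul1r.
have := forc (2 / 3) (fun=> triangle); rewrite p2 => qr.
have i3 : 0 < 3^-1 :> R by rewrite invr_gt0 ltr0n.
(* There are no loops, so one vertex forms an independent set of density 1/3. *)
apply: (@not_quasirandom R 3^-1 3^-1 (fun=> triangle) (fun=> [set 0 : 'I_3]%SET)) => //.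
- by move=> _ u v; rewrite !inE => /eqP -> /eqP ->.
- by move=> _; rewrite cards1 card_ord div1r.
apply: qr.
- by rewrite divr_ge0 //= ler_pdivrMr ?mul1r ?ler_nat.
- by move=> _; exact: oriented_triangle.
- rewrite hom_density_vecK2 nb_edges_triangle /nb_vertices card_ord.
  rewrite (_ : 3 / 3 ^+ 2 = 3^-1) ; first exact: cvg_cst.
  by rewrite expr2 invfM mulrA divff ?mul1r ?pnatr_eq0.
- by rewrite hom_density_triangle //; exact: cvg_cst.
Qed.

(** * Graphs without a homomorphism to a single edge *)

Definition set_digraph (T : finType) (T0 : (0 < #|T|)%N) (S : {set T * T}) : digraph :=
  @Digraph T (fun x y => (x, y) \in S) T0.

Lemma nb_edges_set_digraph (T : finType) (T0 : (0 < #|T|)%N) (S : {set T * T}) :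
  nb_edges (set_digraph T0 S) = #|S|.
Proof. by congr #|pred_of_set _|; apply/setP => -[x y]; rewrite inE. Qed.

Lemma card_family_prod (V T : finType) (F : V -> {set T}) :
  #|[set f : {ffun V -> T} | [forall z, f z \in F z]]%SET| = (\prod_z #|F z|)%N.
Proof.
rewrite (_ : [set _ | _]%SET = [set f in family F]%SET); last by apply/setP => f; rewrite !inE.
by rewrite cardsE card_family foldrE big_map big_enum.
Qed.

Lemma leq_card_bigcup (I T : finType) (P : pred I) (F : I -> {set T}) :
  (#|\bigcup_(i | P i) F i| <= \sum_(i | P i) #|F i|)%N.
Proof.
elim/big_rec2: _ => [|i m A _ le_Am]; first by rewrite cards0.
by apply: leq_trans (leq_card_setU _ _) _; rewrite leq_add2l.
Qed.

(** * Effect on homomorphism counts of changing one arc *)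

Section SetDigraph.
Variables (B : digraph) (T : finType) (T0 : (0 < #|T|)%N).
Hypothesis irreflB : forall x, ~~ edge B x x.
Implicit Types S : {set T * T}.

Let homs S := [set f : {ffun B -> T} | is_hom (G := set_digraph T0 S) f]%SET.

Let card_two_values (x y : B) (a b : T) : x != y ->
  #|[set f : {ffun B -> T} | (f x == a) && (f y == b)]%SET| = (#|T| ^ (#|B| - 2))%N.
Proof.
move=> xy; pose F z : {set T} :=
  (if z == x then [set a] else if z == y then [set b] else [set: T])%SET.
transitivity (\prod_z #|F z|)%N.
  rewrite -card_family_prod; congr #|pred_of_set _|; apply/setP => f; rewrite !inE.
  apply/andP/forallP => [[/eqP fx /eqP fy] z|h].
    rewrite /F; case: eqP => [->|_]; first by rewrite fx inE.
    by case: eqP => [->|_]; rewrite ?fy inE.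
  have := h x; have := h y; rewrite /F eqxx eq_sym (negbTE xy) eqxx !inE.
  by move=> -> ->.
rewrite (bigD1 x) //= (bigD1 y) 1?eq_sym //= /F eqxx eq_sym (negbTE xy) eqxx !cards1 !mul1n.
rewrite (eq_bigr (fun=> #|T|)); last first.
  by move=> z /andP[/negbTE -> /negbTE ->]; rewrite cardsT.
rewrite prod_nat_const; congr (_ ^ _)%N.
rewrite -[in RHS](cardC (pred2 x y)) card2 xy /= addKn.
by apply: eq_card => z; rewrite !inE negb_or.
Qed.

(** A homomorphism that is new in [S'] sends some arc of [B] to [e]. This fixes two of its values
    and leaves [#|B| - 2] free ones. Mere inclusion in [e |: S] lets an arc be dropped while [e] is
    added. *)
Lemma nb_hom_setU1 S S' (e : T * T) : S' \subset (e |: S)%SET ->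
  (nb_hom B (set_digraph T0 S') <=
   nb_hom B (set_digraph T0 S) + nb_edges B * #|T| ^ (#|B| - 2))%N.
Proof.
move=> /fintype.subsetP sub.
pose bad (p : B * B) := [set f : {ffun B -> T} | (f p.1 == e.1) && (f p.2 == e.2)]%SET.
have homs_sub : homs S' \subset homs S :|: \bigcup_(p in edge_set B) bad p.
  apply/fintype.subsetP => f; rewrite !inE => /forallP fS'.
  have [//|/forallPn[x]] := boolP (is_hom _).
  rewrite negb_forall => /existsP[y]; rewrite negb_imply => /andP[xy nS] /=.
  apply/bigcupP; exists (x, y); rewrite inE //=.
  have /forallP/(_ y)/implyP/(_ xy)/sub := fS' x.
  move: nS => /= nS; rewrite in_setU1 (negbTE nS) orbF => /eqP <- /=.
  by rewrite !eqxx.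
apply: leq_trans (subset_leq_card homs_sub) _.
apply: leq_trans (leq_card_setU _ _) _; rewrite leq_add2l.
apply: leq_trans (leq_card_bigcup _ _) _.
rewrite (eq_bigr (fun=> #|T| ^ (#|B| - 2))%N); first by rewrite sum_nat_const.
move=> [x y]; rewrite inE /= => xy; apply: card_two_values.
by apply/eqP => /= exy; move: xy; rewrite exy; apply/negP.
Qed.

(** A discrete intermediate value argument: arcs of [D0] are exchanged for arcs of [D1] one by one,
    and the first stage with at least [c] homomorphisms overshoots by at most one exchange. *)
Lemma exists_intermediate_nb_hom (R : realType) (c : R) (D0 D1 : {set T * T}) :
  (forall z, z \in D0 -> z \notin D1) -> #|D0| = #|D1| ->
  (nb_hom B (set_digraph T0 D0))%:R < c ->
  c <= (nb_hom B (set_digraph T0 D1))%:R ->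
  exists S, [/\ S \subset (D0 :|: D1)%SET, #|S| = #|D1|,
    c <= (nb_hom B (set_digraph T0 S))%:R &
    (nb_hom B (set_digraph T0 S))%:R <= c + (nb_edges B * #|T| ^ (#|B| - 2))%:R].
Proof.
move=> dis card01 lt0 ge1.
(* Stage [k] has the first [k] arcs of [D1] and lacks the first [k] arcs of [D0], so the number of
   arcs stays constant. *)
pose s k := take k (enum D1) ++ drop k (enum D0).
pose S k : {set T * T} := [set z in s k]%SET.
have S0 : S 0 = D0 by apply/setP => z; rewrite inE /s take0 drop0 mem_enum.
have S1 : S #|D1| = D1.
  apply/setP => z; rewrite inE /s drop_oversize -?cardE ?card01 // cats0.
  by rewrite take_oversize -?cardE // mem_enum.
have ex1 : exists k, c <= (nb_hom B (set_digraph T0 (S k)))%:R by exists #|D1|; rewrite S1.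
case: (ex_minnP ex1) => -[|k]; first by rewrite S0 leNgt lt0.
move=> ge_k min_k.
have lek : (k.+1 <= #|D1|)%N by apply: min_k; rewrite S1.
have lt_k : (nb_hom B (set_digraph T0 (S k)))%:R < c.
  by rewrite ltNge; apply/negP => /min_k; rewrite ltnn.
exists (S k.+1); split => //.
- apply/fintype.subsetP => z; rewrite !inE /s mem_cat => /orP[/mem_take|/mem_drop].
    by rewrite mem_enum => ->; rewrite orbT.
  by rewrite mem_enum => ->.
- rewrite cardsE (card_uniqP _) ?size_cat ?size_take ?size_drop -?cardE ?card01.
    move: lek; rewrite leq_eqVlt => /orP[/eqP ->|lt]; rewrite ?ltnn ?subnn ?addn0 //.
    by rewrite lt subnKC // ltnW.
  rewrite cat_uniq take_uniq ?enum_uniq // drop_uniq ?enum_uniq // andbT /=.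
  apply/hasPn => z /mem_drop; rewrite mem_enum => z0; apply/negP => /mem_take.
  by rewrite mem_enum; apply/negP; exact: dis.
- have [D1_0|[z0 _]] := set_0Vmem D1; first by move: lek; rewrite D1_0 cards0.
  (* The only arc gained between consecutive stages is number [k] of [D1]. *)
  have sub : S k.+1 \subset (nth z0 (enum D1) k |: S k)%SET.
    apply/fintype.subsetP => z; rewrite !inE /s !mem_cat.
    rewrite (take_nth z0) -?cardE // mem_rcons inE -orbA => /or3P[->|->|zd]; rewrite ?orbT //.
    by rewrite -add1n -drop_drop in zd; rewrite (mem_drop zd) !orbT.
  apply: le_trans
    (_ : (nb_hom B (set_digraph T0 (S k)) + nb_edges B * #|T| ^ (#|B| - 2))%:R <= _).
    by rewrite ler_nat; exact: nb_hom_setU1 sub.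
  by rewrite natrD lerD2r ltW.
Qed.

End SetDigraph.

(** * Non-isolated vertices and blow-ups *)

Definition endpoints (B : digraph) : {set B} :=
  ([set e.1 | e in edge_set B] :|: [set e.2 | e in edge_set B])%SET.

(** If no vertex were both a tail and a head, marking the heads would be a homomorphism to [vecK2].
    So some vertex is counted twice among the at most [nb_edges B] tails and as many heads. *)
Lemma card_endpoints (B : digraph) : ~ has_hom B vecK2 ->
  (#|endpoints B| < 2 * nb_edges B)%N.
Proof.
move=> nohom.
have [x] : exists x, (x \in [set e.1 | e in edge_set B] :&: [set e.2 | e in edge_set B])%SET.
  apply: contrapT => none; apply: nohom.
  exists (fun x => x \in [set e.2 | e in edge_set B]%SET).
  apply/forallP => x; apply/forallP => y.
  apply/implyP => xy; apply/andP; split; last first.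
    by apply/imsetP; exists (x, y) => //; rewrite inE.
  apply/negP => xin; apply: none; exists x; rewrite inE xin andbT.
  by apply/imsetP; exists (x, y) => //; rewrite inE.
move=> xI; rewrite /endpoints cardsU mul2n -addnn.
set t := [set _ | _ in _]%SET; set h := [set e.2 | e in _]%SET.
have I0 : (0 < #|t :&: h|)%N by apply/card_gt0P; exists x.
have It : (#|t :&: h| <= #|t|)%N by apply: subset_leq_card; exact: subsetIl.
have lt_t : (#|t| <= nb_edges B)%N by exact: leq_imset_card.
have lt_h : (#|h| <= nb_edges B)%N by exact: leq_imset_card.
rewrite ltn_subLR; last by rewrite (leq_trans It) // leq_addr.
by apply: leq_ltn_trans (leq_add lt_t lt_h) _; rewrite -[X in (X < _)%N]add0n ltn_add2r.
Qed.

Section Blowup.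
Variables (K : finType) (n : nat).

Definition blowup (F : {set K * K}) : {set (K * 'I_n) * (K * 'I_n)} :=
  [set z | (z.1.1, z.2.1) \in F]%SET.

Lemma card_blowup F : #|blowup F| = (#|F| * n ^ 2)%N.
Proof.
pose g (z : (K * K) * ('I_n * 'I_n)) := ((z.1.1, z.2.1), (z.1.2, z.2.2)).
have g_inj : injective g by move=> [[a b] [c d]] [[a' b'] [c' d']] [-> -> -> ->].
have -> : blowup F = g @: finset.setX F [set: 'I_n * 'I_n]%SET.
  apply/setP => -[[a c] [b d]]; rewrite inE /=; apply/idP/imsetP => [abF|].
    by exists ((a, b), (c, d)) => //; rewrite inE /= abF inE.
  by case=> -[[a' b'] [c' d']]; rewrite inE /= => /andP[abF _] [-> _ -> _].
by rewrite (card_imset _ g_inj) cardsX cardsT card_prod !card_ord.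
Qed.

(** Every map sending each endpoint [x] into the class of [h x] is a homomorphism: [n] choices for
    an endpoint, [#|K| * n] for an isolated vertex. *)
Lemma nb_hom_blowup_ge (B : digraph) (h : B -> K) (F : {set K * K}) T0 :
  (forall x y, edge B x y -> (h x, h y) \in F) ->
  (n ^ #|endpoints B| * (#|K| * n) ^ (#|B| - #|endpoints B|) <=
   nb_hom B (@set_digraph (K * 'I_n)%type T0 (blowup F)))%N.
Proof.
move=> hF.
pose I x : {set K * 'I_n} :=
  (if x \in endpoints B then finset.setX [set h x] finset.setT else finset.setT)%SET.
apply: (@leq_trans #|[set f : {ffun B -> K * 'I_n} | [forall z, f z \in I z]]%SET|).
  rewrite card_family_prod (bigID (fun x => x \in endpoints B)) /=.
  rewrite (eq_bigr (fun=> n)); last first.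
    by move=> x xe; rewrite /I xe cardsX cards1 mul1n cardsT card_ord.
  rewrite prod_nat_const (eq_bigr (fun=> #|K| * n)%N); last first.
    by move=> x /negbTE xe; rewrite /I xe cardsT card_prod card_ord.
  rewrite prod_nat_const leq_mul2l; apply/orP; right.
  rewrite -[#|B|](cardC (mem (endpoints B))) addKn.
  by rewrite leqnn.
apply: subset_leq_card; apply/fintype.subsetP => f; rewrite !inE => /forallP fI.
apply/forallP => x; apply/forallP => y; apply/implyP => xy; rewrite /= inE /=.
have := fI x; have := fI y; rewrite /I /endpoints !inE.
have -> : x \in [set e.1 | e in edge_set B]%SET.
  by apply/imsetP; exists (x, y) => //; rewrite inE.
have -> : y \in [set e.2 | e in edge_set B]%SET.
  by apply/imsetP; exists (x, y) => //; rewrite inE.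
by rewrite orbT /= !inE !andbT => /eqP -> /eqP ->; exact: hF.
Qed.

End Blowup.

(** Cancelling common factors leaves [c <= k ^ (d - t)], which follows from [c <= k] because [d - t]
    is at least 1. It is applied with [c = e ^ e], [k = #|K|] and [d = 2 * e]. *)
Lemma blowup_count_le (c k n t b d : nat) :
  (c <= k)%N -> (t <= b)%N -> (t < d)%N ->
  (c * (k * n) ^ b <= n ^ t * (k * n) ^ (b - t) * k ^ d)%N.
Proof.
move=> le_ck le_tb lt_td.
have -> : ((k * n) ^ b = k ^ t * (n ^ t * (k * n) ^ (b - t)))%N.
  by rewrite mulnA -expnMn -expnD subnKC.
have -> : (k ^ d = k ^ (d - t) * k ^ t)%N by rewrite -expnD subnK // ltnW.
rewrite mulnA [leqRHS]mulnC leq_mul2r leq_mul2r; apply/orP; right; apply/orP; right.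
case: k le_ck => [|k] le_ck; first by move: le_ck; rewrite leqn0 => /eqP ->.
by apply: leq_trans le_ck _; rewrite -{1}[k.+1]expn1 leq_pexp2l // subn_gt0.
Qed.

(** * Interpolation between the blow-ups of a star and of [B] *)

Section Interpolation.
Variables (R : realType) (B : digraph).
Hypotheses (oB : oriented B) (nohom : ~ has_hom B vecK2).

Let e := nb_edges B.
(** A copy of [B], then the [e] leaves of a star, then [(e ^ e).+1] vertices of which [ord0] is the
    centre of the star; the last summand ensures [e ^ e <= #|K|]. *)
Let K : finType := (B + ('I_e + 'I_(e ^ e).+1))%type.
(** The common edge density of the two blow-ups, whatever the class size: both patterns have [e]
    arcs. *)
Let q : R := e%:R / #|K|%:R ^+ 2.

Let F0 : {set K * K} :=
  [set p | if p is (inr (inl _), inr (inr j)) then j == ord0 else false]%SET.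
Let F1 : {set K * K} :=
  [set p | if p is (inl x, inl y) then edge B x y else false]%SET.

Let card_K : #|K| = (#|B| + (e + (e ^ e).+1))%N.
Proof. by rewrite !card_sum !card_ord. Qed.

Let card_F0 : #|F0| = e.
Proof.
pose g (i : 'I_e) : K * K := (inr (inl i), inr (inr ord0)).
rewrite -[RHS](card_ord e) -(card_imset _ (f := g)); last by move=> i j [].
congr #|pred_of_set _|; apply/setP => p; rewrite inE; apply/idP/imsetP.
  by case: p => [[x|[i|j]] [y|[i'|j']]] //= /eqP ->; exists i.
by case=> i _ -> /=.
Qed.

Let card_F1 : #|F1| = e.
Proof.
pose g (p : B * B) : K * K := (inl p.1, inl p.2).
rewrite /e /nb_edges -(card_imset _ (f := g)); last by move=> [x y] [x' y'] [-> ->].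
congr #|pred_of_set _|; apply/setP => p; rewrite inE; apply/idP/imsetP.
  by case: p => [[x|[i|j]] [y|[i'|j']]] //= xy; exists (x, y); rewrite ?inE.
by case=> -[x y]; rewrite inE /= => xy ->.
Qed.

Let e_gt0 : (0 < e)%N.
Proof. by move: (card_endpoints nohom); rewrite -/e; case: e. Qed.

Let card_K_gt0 : (0 < #|K|)%N.
Proof. by rewrite card_K !addnS. Qed.

Let q_gt0 : 0 < q.
Proof. by rewrite divr_gt0 ?exprn_gt0 ?ltr0n. Qed.

Let card_B_gt1 : (1 < #|B|)%N.
Proof.
have /card_gt0P[[x y]] := e_gt0; rewrite inE /= => xy.
rewrite (cardD1 x) (cardD1 y) !inE andbT.
by case: eqP xy => [->|//]; rewrite (negbTE (oB.1 x)).
Qed.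

(* The graph lies between the blow-up [D1] of [B] and the blow-up [D0] of a star
   oriented towards its centre, into which [B] has no homomorphism; the centre's class
   is independent, and the [(e ^ e).+1] leftover vertices of [K] make
   [t(B, D1) >= q ^ e]. *)
Lemma exists_interpolating_graph (n : nat) : (0 < n)%N ->
  exists (G : digraph) (A : {set G}),
    [/\ oriented G,
        forall u v, u \in A -> v \in A -> ~~ edge G u v,
        #|A|%:R / #|G|%:R = #|K|%:R^-1 :> R,
        hom_density R vecK2 G = q &
        q ^+ e <= hom_density R B G <= q ^+ e + e%:R / n%:R].
Proof.
move=> n0; pose T : finType := (K * 'I_n)%type.
have cardT : #|T| = (#|K| * n)%N by rewrite card_prod card_ord.
have T0 : (0 < #|T|)%N by rewrite cardT muln_gt0 card_K_gt0.
have T0R : 0 < #|T|%:R :> R by rewrite ltr0n.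
pose D0 : {set T * T} := blowup n F0; pose D1 : {set T * T} := blowup n F1.
have D01 z : z \in D0 -> z \notin D1.
  by rewrite !inE; case: z => [[[x|[i|j]] a] [[y|[i'|j']] b]].
have card_eq : #|D0| = #|D1| by rewrite !card_blowup card_F0 card_F1.
(* The number of homomorphisms that corresponds to density [q ^+ e]. *)
pose c : R := q ^+ e * #|T|%:R ^+ #|B|.
have c0 : 0 < c by rewrite mulr_gt0 // exprn_gt0.
(* Arcs of [D0] run from leaf classes to the centre class, so a homomorphism into [D0] would induce
   one to [vecK2]. *)
have hom0 : nb_hom B (set_digraph T0 D0) = 0.
  apply/eqP; rewrite cards_eq0; apply/eqP/setP => f; rewrite !inE.
  apply/negP => /forallP hf; apply: nohom.
  exists (fun x => if (f x).1 is inr (inr _) then true else false).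
  apply/forallP => x; apply/forallP => y; apply/implyP => xy.
  move: (hf x) => /forallP/(_ y)/implyP/(_ xy) /=; rewrite inE /=.
  by case: (f x).1 => [?|[?|?]] //=; case: (f y).1 => [?|[?|?]]; rewrite ?inE.
have hom1 : c <= (nb_hom B (set_digraph T0 D1))%:R.
  have := @nb_hom_blowup_ge K n B inl F1 T0.
  have edgeF1 (x y : B) : edge B x y -> (inl x, inl y) \in F1 by rewrite inE.
  move=> /(_ edgeF1); rewrite -(ler_nat R); apply: le_trans.
  have lt_t := card_endpoints nohom.
  have le_tB : (#|endpoints B| <= #|B|)%N by exact: max_card.
  rewrite -/e in lt_t; move: lt_t le_tB; set t := #|endpoints B| => lt_t le_tB.
  rewrite /c /q expr_div_n -exprM mulrAC ler_pdivrMr ?exprn_gt0 ?ltr0n //.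
  rewrite -!natrX -!natrM ler_nat cardT.
  apply: blowup_count_le => //; rewrite card_K !addnS addnA; apply: leqW.
  exact: leq_addl.
have [|S [subS cardS geS leS]] := exists_intermediate_nb_hom oB.1 D01 card_eq _ hom1.
  by rewrite hom0.
have inS z : z \in S -> (z \in D0) || (z \in D1).
  by move=> /(fintype.subsetP subS); rewrite inE.
(* No arc of [F0] or [F1] starts at the centre, so its class is independent; it has [n] of the
   [#|K| * n] vertices. *)
exists (set_digraph T0 S), [set z : T | z.1 == inr (inr ord0)]%SET; split.
- have [irr anti] := oB; split=> [x|x y]; apply/negP => /=.
    move=> /inS; rewrite !inE /=.
    by case: x.1 => [z|[i|j]] //=; rewrite (negbTE (irr z)).
  move=> /andP[/inS + /inS]; rewrite !inE /=.
  case: x.1 => [z|[i|j]]; case: y.1 => [z'|[i'|j']] //= zz' z'z.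
  by have := anti z z'; rewrite zz' z'z.
- move=> u v; rewrite !inE => /eqP u1 _; apply/negP => /inS.
  by rewrite !inE /= u1.
- rewrite (_ : #|_| = n); last first.
    rewrite (_ : [set _ | _]%SET = finset.setX [set inr (inr ord0)] finset.setT).
      by rewrite cardsX cards1 mul1n cardsT card_ord.
    by apply/setP => z; rewrite !inE andbT.
  rewrite /= cardT natrM invfM mulrCA divff ?mulr1 //.
  by rewrite pnatr_eq0 -lt0n.
- rewrite hom_density_vecK2 nb_edges_set_digraph cardS card_blowup card_F1.
  rewrite /nb_vertices /= cardT natrM natrX /q natrM exprMn.
  have nX0 : n%:R ^+ 2 != 0 :> R by rewrite expf_neq0 // pnatr_eq0 -lt0n.
  by rewrite invfM mulrACA divff ?mulr1.
(* Dividing by [#|T| ^ #|B|] turns the overshoot into [e / #|T| ^ 2], at most [e / n] since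
   [n <= #|T|]. *)
- have TB0 : 0 < #|T|%:R ^+ #|B| :> R by rewrite exprn_gt0.
  rewrite /hom_density /nb_vertices ler_pdivlMr // geS ler_pdivrMr // mulrDl.
  apply: le_trans leS _; rewrite lerD2l -[X in _ ^+ X](subnKC card_B_gt1) exprD.
  rewrite natrM natrX mulrA ler_pM2r ?exprn_gt0 //.
  rewrite -mulrA ler_pMr ?ltr0n // mulrC ler_pdivlMr ?ltr0n // mul1r.
  rewrite -natrX ler_nat cardT (leq_trans _ (leq_pexp2l _ (isT : 1 <= 2)%N)) //.
    by rewrite expn1 leq_pmull.
  by rewrite muln_gt0 card_K_gt0.
Qed.

Lemma not_directed_forcing : ~ directed_forcing R B.
Proof.
move=> forc.
have ex n := exists_interpolating_graph (ltn0Sn n).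
(* Term [n] of the sequence uses classes of size [n.+1], which is never 0. *)
pose G n := projT1 (cid (ex n)); pose A n := projT1 (cid (projT2 (cid (ex n)))).
have GA n : [/\ oriented (G n),
        forall u v, u \in A n -> v \in A n -> ~~ edge (G n) u v,
        #|A n|%:R / #|G n|%:R = #|K|%:R^-1 :> R,
        hom_density R vecK2 (G n) = q &
        q ^+ e <= hom_density R B (G n) <= q ^+ e + e%:R / n.+1%:R].
  exact: projT2 (cid (projT2 (cid (ex n)))).
have q2 : (2 * q) / 2 = q by rewrite mulrAC divff ?mul1r ?pnatr_eq0.
have := forc (2 * q) G; rewrite q2 => qr.
apply: (@not_quasirandom R q #|K|%:R^-1 G A) => //.
- by rewrite invr_gt0 ltr0n.
- by move=> n; case: (GA n).
- by move=> n; case: (GA n) => _ _ ->.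
apply: qr.
(* [p = 2 * q] is at most 1 because [2 * e <= e.+1 ^ 2 <= #|K| ^ 2]. *)
- rewrite mulr_ge0 ?(ltW q_gt0) //= /q mulrA ler_pdivrMr ?exprn_gt0 ?ltr0n // mul1r.
  rewrite -natrM -natrX ler_nat (@leq_trans (e.+1 ^ 2)) //.
    by rewrite -[e.+1]addn1 sqrnD muln1 leq_addl.
  by rewrite leq_exp2r // card_K !addnS ltnS addnCA leq_addr.
- by move=> n; case: (GA n).
- by rewrite (_ : (fun _ => _) = fun=> q); [exact: cvg_cst|apply/funext => n; case: (GA n)].
- apply: (@squeeze_cvgr _ _ _ _ (fun=> q ^+ e) (fun n => q ^+ e + e%:R / n.+1%:R)).
  + by near=> n; case: (GA n).
  + exact: cvg_cst.
  + rewrite -[X in _ --> X]addr0; apply: cvgD; first exact: cvg_cst.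
    rewrite -[X in _ --> X](mulr0 e%:R); apply: cvgM; first exact: cvg_cst.
    exact: cvg_harmonic.
Unshelve. all: by end_near.
Qed.

End Interpolation.

Theorem theorem1p6 (R : realType) (B : digraph) (hB : oriented B) :
  directed_forcing R B ->
  has_hom B vecK2 /\ contains_cycle (underlying B).
Proof.
move=> forc; split; last exact: directed_forcing_cycle hB forc.
by apply: contrapT => nohom; exact: (not_directed_forcing hB nohom forc).
Qed.
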